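(* $$\frac{16+3\pi^2}{16-\pi^2}=\mathrm{CF}\left[3n^2+9n+7,\,-(n+1)^3(2n-3)\right].$$
   Context: For sequences $(a_n)_{n\ge0}$, $(b_n)_{n\ge1}$, $\mathrm{CF}[a_n,b_n]$ denotes the continued fraction $a_0+\cfrac{b_1}{a_1+\cfrac{b_2}{a_2+\ddots}}$, whose value is $\lim_{n\to\infty}A_n/B_n$, where $A_0=1$, $A_1=a_0$, $B_0=0$, $B_1=1$, and $A_{n+1}=a_nA_n+b_nA_{n-1}$, $B_{n+1}=a_nB_n+b_nB_{n-1}$ for $n\ge1$. *)

(* Defs.v *)
From Stdlib Require Import Reals.
From Coquelicot Require Import Coquelicot.
Open Scope R_scope.

(* Convergents of CF[a_n, b_n]: cf_num a b n / cf_den a b n is A_n / B_n, with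
   A_(n+1) = a_n A_n + b_n A_(n-1) for n >= 1 and similarly for B. Indices are
   shifted by one: A_2 / B_2 = a_0 + b_1 / a_1. The value b 0 is never used. *)
Fixpoint cf_num (a b : nat -> R) (n : nat) {struct n} : R :=
  match n with
  | O => 1
  | S m => match m with
           | O => a O
           | S k => a m * cf_num a b m + b m * cf_num a b k
           end
  end.

Fixpoint cf_den (a b : nat -> R) (n : nat) {struct n} : R :=
  match n with
  | O => 0
  | S m => match m with
           | O => 1
           | S k => a m * cf_den a b m + b m * cf_den a b k
           end
  end.

(* The first conjunct makes A_n / B_n a genuine quotient for all large n, since
   division is total on R (and B_0 = 0). *)
Definition is_CF (a b : nat -> R) (l : R) : Prop :=
  eventually (fun n => cf_den a b n <> 0) /\
  is_lim_seq (fun n => cf_num a b n / cf_den a b n) (Finite l).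

(* Main.v *)
Require Import Defs.
From Stdlib Require Import Reals.
From Coquelicot Require Import Coquelicot.
From Stdlib Require Import Lra.
Open Scope R_scope.

(** The recurrence u_(n+1) = a_n u_n + b_n u_(n-1) has a closed form solution
    X_n = (n+1)! * prod_(k<n) (2k-1) * c(n) with c a quartic polynomial, and a
    second one Y_n with Y_n / X_n = S_n + o(1), where S_n is the partial sum of
    sum_(k>=1) k! / ((2k-1)!! k^2). The initial values give 64 A = -2X - 3Y and
    64 B = -2X + Y, so that A_n / B_n tends to (-2 - 3S) / (-2 + S). Finally
    S = PI^2/8 is the case x = PI/4 of
    2 x^2 = sum_(k>=1) k! / ((2k-1)!! k^2) * (2 sin(x)^2)^k, in which the
    remainder of the series has an explicit small second derivative. *)

(** * The series of the squared arcsine and its value at PI/4 *)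

(* [odd_quot n] is n! / (2n-1)!! *)
Fixpoint odd_quot (n : nat) : R :=
  match n with
  | O => 1
  | S k => odd_quot k * ((INR k + 1) / (2 * INR k + 1))
  end.

(** Because of the shift, [n] counts the terms k = 1, ..., n+1. *)
Definition odd_quot_sum (n : nat) : R := sum_f_R0 (fun k => odd_quot (S k) / INR (S k) ^ 2) n.

Lemma odd_quot_pos n : 0 < odd_quot n.
Proof.
  induction n as [|n IH]; simpl; [lra|].
  pose proof (pos_INR n).
  apply Rmult_lt_0_compat; [exact IH|apply Rdiv_lt_0_compat; lra].
Qed.

(** The factor (k+1)/(2k+1) is 1 at k = 0 and at most 2/3 from k = 1 on, hence the shifted index. *)
Lemma odd_quot_S_le n : odd_quot (S n) <= (2 / 3) ^ n.
Proof.
  induction n as [|n IH]; [simpl; lra|].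
  change (odd_quot (S (S n))) with (odd_quot (S n) * ((INR (S n) + 1) / (2 * INR (S n) + 1))).
  rewrite S_INR. pose proof (pos_INR n). pose proof (odd_quot_pos (S n)).
  replace ((2 / 3) ^ S n) with ((2 / 3) ^ n * (2 / 3)) by (simpl; ring).
  apply Rmult_le_compat; [lra| |exact IH|].
  - apply Rlt_le, Rdiv_lt_0_compat; lra.
  - apply Rle_div_l; lra.
Qed.

Lemma odd_quot_S_lim : is_lim_seq (fun n => odd_quot (S n)) 0.
Proof.
  apply is_lim_seq_le_le with (u := fun _ => 0) (w := fun n => (2 / 3) ^ n).
  - intro n. split; [apply Rlt_le, odd_quot_pos|apply odd_quot_S_le].
  - apply is_lim_seq_const.
  - apply is_lim_seq_geom. rewrite Rabs_pos_eq; lra.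
Qed.

(** Partial sum of the classical series of 2 arcsin(y)^2 at y = sin x; in the variable x all
    derivatives are polynomials in sin and cos. *)
Definition arcsin_sq_sum (n : nat) (x : R) : R :=
  sum_f_R0 (fun k => odd_quot (S k) / INR (S k) ^ 2 * (2 * sin x ^ 2) ^ S k) n.

Definition arcsin_sq_sum' (n : nat) (x : R) : R :=
  sum_f_R0
    (fun k => odd_quot (S k) / INR (S k) * (2 * sin x ^ 2) ^ k * (4 * sin x * cos x)) n.

Lemma is_derive_arcsin_sq_sum n x :
  is_derive (arcsin_sq_sum n) x (arcsin_sq_sum' n x).
Proof.
  assert (H : forall k, is_derive
    (fun x => odd_quot (S k) / INR (S k) ^ 2 * (2 * sin x ^ 2) ^ S k) x
    (odd_quot (S k) / INR (S k) * (2 * sin x ^ 2) ^ k * (4 * sin x * cos x))).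
  { intro k. pose proof (pos_INR k).
    auto_derive; [easy|].
    change (match k with O => 1 | S _ => INR k + 1 end) with (INR (S k)).
    change (odd_quot k * ((INR k + 1) / (2 * INR k + 1))) with (odd_quot (S k)).
    change (2 * (sin x * (sin x * 1))) with (2 * sin x ^ 2).
    rewrite S_INR. field. lra. }
  induction n as [|n IH].
  - apply (H O).
  - apply (is_derive_plus (arcsin_sq_sum n)); [exact IH|apply (H (S n))].
Qed.

(* The second derivative telescopes, since (sin^(2k))'' is
   2k(2k-1) sin^(2k-2) - 4k^2 sin^(2k). *)
Lemma is_derive_arcsin_sq_sum' n x :
  is_derive (arcsin_sq_sum' n) x (4 - 4 * odd_quot (S n) * (2 * sin x ^ 2) ^ S n).
Proof.
  assert (C : cos x * cos x = 1 - sin x * sin x)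
    by (pose proof (sin2_cos2 x); unfold Rsqr in *; lra).
  induction n as [|n IH].
  - apply (is_derive_ext (fun x => 4 * sin x * cos x)).
    + intro y. unfold arcsin_sq_sum'. simpl. field.
    + auto_derive; [easy|]. simpl. lra.
  - replace (4 - 4 * odd_quot (S (S n)) * (2 * sin x ^ 2) ^ S (S n)) with
      (plus (4 - 4 * odd_quot (S n) * (2 * sin x ^ 2) ^ S n)
        (4 * odd_quot (S n) * (2 * sin x ^ 2) ^ S n
          - 4 * odd_quot (S (S n)) * (2 * sin x ^ 2) ^ S (S n)))
      by (unfold plus; simpl; ring).
    apply (is_derive_plus (arcsin_sq_sum' n)); [exact IH|].
    pose proof (pos_INR n).
    auto_derive; [easy|].
    change (match n with O => 1 | S _ => INR n + 1 end) with (INR (S n)).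
    change (odd_quot n * ((INR n + 1) / (2 * INR n + 1))) with (odd_quot (S n)).
    change (odd_quot (S (S n))) with (odd_quot (S n) * ((INR (S n) + 1) / (2 * INR (S n) + 1))).
    change (2 * (sin x * (sin x * 1))) with (2 * sin x ^ 2).
    rewrite !S_INR, <- !(tech_pow_Rmult (2 * sin x ^ 2)).
    generalize ((2 * sin x ^ 2) ^ n) (odd_quot (S n)). intros y u.
    field [C]. lra.
Qed.

Lemma sin_sq_bound x : 0 <= x <= PI / 4 -> 0 <= 2 * sin x ^ 2 <= 1.
Proof.
  intros Hx. split; [pose proof (pow2_ge_0 (sin x)); lra|].
  pose proof (cos_2a_sin x).
  assert (0 <= cos (2 * x)) by (apply cos_ge_0; lra).
  lra.
Qed.

Lemma arcsin_sq_sum_0 n : arcsin_sq_sum n 0 = 0.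
Proof.
  unfold arcsin_sq_sum. rewrite sin_0.
  apply sum_eq_R0. intros k _. simpl. ring.
Qed.

Lemma arcsin_sq_sum'_0 n : arcsin_sq_sum' n 0 = 0.
Proof.
  unfold arcsin_sq_sum'. rewrite sin_0.
  apply sum_eq_R0. intros k _. ring.
Qed.

Lemma arcsin_sq_sum_PI4 n : arcsin_sq_sum n (PI / 4) = odd_quot_sum n.
Proof.
  apply sum_eq. intros k _.
  replace (2 * sin (PI / 4) ^ 2) with 1; [rewrite pow1; ring|].
  pose proof (cos_2a_sin (PI / 4)) as H.
  replace (2 * (PI / 4)) with (PI / 2) in H by field.
  rewrite cos_PI2 in H. lra.
Qed.

(** The remainder and its derivative vanish at 0, so two mean value steps, with 0 < z < y < x, write
    it as its second derivative at z times y x. That derivative is 4 [odd_quot (S n)] times a power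
    of 2 sin(z)^2, which lies in [0, 1]. *)
Lemma arcsin_sq_remainder n x :
  0 < x <= PI / 4 ->
  0 <= 2 * x ^ 2 - arcsin_sq_sum n x <= 4 * x ^ 2 * odd_quot (S n).
Proof.
  intros Hx.
  destruct (MVT_cor2 (fun y => 2 * y ^ 2 - arcsin_sq_sum n y)
    (fun y => 4 * y - arcsin_sq_sum' n y) 0 x) as (y & Ey & Hy); [lra| |].
  { intros y _. apply is_derive_Reals.
    apply (is_derive_minus (fun y => 2 * y ^ 2)).
    - auto_derive; [easy|ring].
    - apply is_derive_arcsin_sq_sum. }
  destruct (MVT_cor2 (fun y => 4 * y - arcsin_sq_sum' n y)
    (fun y => 4 - (4 - 4 * odd_quot (S n) * (2 * sin y ^ 2) ^ S n)) 0 y)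
    as (z & Ez & Hz); [lra| |].
  { intros z _. apply is_derive_Reals.
    apply (is_derive_minus (fun y => 4 * y)).
    - auto_derive; [easy|ring].
    - apply is_derive_arcsin_sq_sum'. }
  rewrite arcsin_sq_sum_0 in Ey. rewrite arcsin_sq_sum'_0 in Ez.
  pose proof (odd_quot_pos (S n)) as Ht.
  assert (Hs : 0 <= (2 * sin z ^ 2) ^ S n <= 1).
  { pose proof (sin_sq_bound z ltac:(lra)). split.
    - apply pow_le; lra.
    - rewrite <- (pow1 (S n)). apply pow_incr. lra. }
  set (q := (2 * sin z ^ 2) ^ S n) in *.
  assert (Q : 2 * x ^ 2 - arcsin_sq_sum n x = 4 * (odd_quot (S n) * q) * (y * x)).
  { transitivity ((4 * y - arcsin_sq_sum' n y) * x); [lra|].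
    replace (4 * y - arcsin_sq_sum' n y) with (4 * (odd_quot (S n) * q) * y) by lra.
    ring. }
  rewrite Q.
  assert (0 <= odd_quot (S n) * q <= odd_quot (S n)) by nra.
  assert (0 <= y * x <= x ^ 2) by nra.
  split.
  - apply Rmult_le_pos; lra.
  - replace (4 * x ^ 2 * odd_quot (S n)) with (4 * odd_quot (S n) * x ^ 2) by ring.
    apply Rmult_le_compat; lra.
Qed.

Lemma odd_quot_sum_lim : is_lim_seq odd_quot_sum (PI ^ 2 / 8).
Proof.
  pose proof PI_RGT_0.
  (* At x = PI/4, 2 x^2 is PI^2/8 and the error factor 4 x^2 is PI^2/4. *)
  apply is_lim_seq_le_le with
    (u := fun n => PI ^ 2 / 8 - PI ^ 2 / 4 * odd_quot (S n)) (w := fun _ => PI ^ 2 / 8).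
  - intro n. pose proof (arcsin_sq_remainder n (PI / 4) ltac:(lra)) as B.
    rewrite arcsin_sq_sum_PI4 in B. lra.
  - replace (Finite (PI ^ 2 / 8)) with (Finite (PI ^ 2 / 8 - PI ^ 2 / 4 * 0))
      by (f_equal; ring).
    apply is_lim_seq_minus'; [apply is_lim_seq_const|].
    apply (is_lim_seq_scal_l _ (PI ^ 2 / 4) 0), odd_quot_S_lim.
  - apply is_lim_seq_const.
Qed.

(** * Explicit solutions of the recurrence *)

(* [hyp n] is (n+1)! * prod_(k<n) (2k-1). *)
Fixpoint hyp (n : nat) : R :=
  match n with
  | O => 1
  | S k => (2 * INR k - 1) * (INR k + 2) * hyp k
  end.

(* [hyp n * cpoly n] solves the recurrence of the convergents. Summing its
   Casoratian, reduced modulo telescoping terms, gives the second solution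
   [hyp n * (cpoly n * odd_quot_sum n + ppoly n * odd_quot (S n))]. *)
Definition cpoly (n : nat) : R :=
  INR n ^ 4 + 14 * INR n ^ 3 + 39 * INR n ^ 2 - 6 * INR n - 8.

Definition ppoly (n : nat) : R := INR n ^ 2 + 9 * INR n - 8.

Definition sol (r s : R) (n : nat) : R :=
  hyp n * (cpoly n * (r + s * odd_quot_sum n) + s * ppoly n * odd_quot (S n)).

Lemma hyp_neq_0 n : hyp n <> 0.
Proof.
  induction n as [|n IH]; simpl; [lra|].
  pose proof (pos_INR n).
  repeat apply Rmult_integral_contrapositive_currified; [|lra|exact IH].
  (* The factor 2n - 1 is -1 at n = 0 and positive afterwards. *)
  destruct n as [|n]; [simpl; lra|].
  rewrite S_INR. pose proof (pos_INR n). lra.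
Qed.

Lemma ppoly_le_cpoly n : cpoly n <> 0 /\ Rabs (ppoly n) <= Rabs (cpoly n).
Proof.
  unfold cpoly, ppoly. destruct n as [|n].
  - simpl. split; [lra|]. right. f_equal. ring.
  (* In m, the polynomials become m^4 + 18m^3 + 87m^2 + 118m + 40 and m^2 + 11m + 2, so they compare
     coefficientwise. *)
  - rewrite S_INR. pose proof (pos_INR n) as H. set (m := INR n) in *.
    assert (0 <= m ^ 2) by (apply pow_le; lra).
    assert (0 <= m ^ 3) by (apply pow_le; lra).
    assert (0 <= m ^ 4) by (apply pow_le; lra).
    split; [nra|]. rewrite !Rabs_pos_eq; nra.
Qed.

Lemma sol_recurrence r s n :
  sol r s (S (S n)) =
    (3 * INR (S n) ^ 2 + 9 * INR (S n) + 7) * sol r s (S n)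
    + - ((INR (S n) + 1) ^ 3 * (2 * INR (S n) - 3)) * sol r s n.
Proof.
  unfold sol, odd_quot_sum, cpoly, ppoly. rewrite !tech5.
  change (odd_quot (S (S (S n)))) with
    (odd_quot (S (S n)) * ((INR (S (S n)) + 1) / (2 * INR (S (S n)) + 1))).
  change (odd_quot (S (S n))) with
    (odd_quot (S n) * ((INR (S n) + 1) / (2 * INR (S n) + 1))).
  cbn [hyp]. rewrite !S_INR.
  (* Everything is now expressed through one partial sum, one [odd_quot] and one [hyp]; with these
     as free variables a rational identity remains. *)
  generalize (sum_f_R0 (fun k => odd_quot (S k) / INR (S k) ^ 2) n) (odd_quot (S n)) (hyp n).
  pose proof (pos_INR n). intros e u v.
  field. lra.
Qed.

(** Two initial values fix a solution. Those of [sol r s] are -8r - 16s and -80r - 96s; they must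
    equal 64 and 64 * 7 here, and 0 and 64 for the denominators. *)
Lemma cf_num_sol n :
  64 * cf_num (fun n : nat => 3 * INR n ^ 2 + 9 * INR n + 7)
    (fun n : nat => - ((INR n + 1) ^ 3 * (2 * INR n - 3))) n = sol (-2) (-3) n.
Proof.
  set (a := fun n : nat => _). set (b := fun n : nat => - _).
  enough (64 * cf_num a b n = sol (-2) (-3) n /\
          64 * cf_num a b (S n) = sol (-2) (-3) (S n)) by tauto.
  induction n as [|n [IH0 IH1]].
  - unfold sol, odd_quot_sum, cpoly, ppoly, a. simpl. split; field.
  - split; [exact IH1|]. rewrite sol_recurrence, <- IH0, <- IH1.
    change (cf_num a b (S (S n))) with
      (a (S n) * cf_num a b (S n) + b (S n) * cf_num a b n).
    unfold a at 1, b at 2. ring.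
Qed.

Lemma cf_den_sol n :
  64 * cf_den (fun n : nat => 3 * INR n ^ 2 + 9 * INR n + 7)
    (fun n : nat => - ((INR n + 1) ^ 3 * (2 * INR n - 3))) n = sol (-2) 1 n.
Proof.
  set (a := fun n : nat => _). set (b := fun n : nat => - _).
  enough (64 * cf_den a b n = sol (-2) 1 n /\
          64 * cf_den a b (S n) = sol (-2) 1 (S n)) by tauto.
  induction n as [|n [IH0 IH1]].
  - unfold sol, odd_quot_sum, cpoly, ppoly. simpl. split; field.
  - split; [exact IH1|]. rewrite sol_recurrence, <- IH0, <- IH1.
    change (cf_den a b (S (S n))) with
      (a (S n) * cf_den a b (S n) + b (S n) * cf_den a b n).
    unfold a at 1, b at 2. ring.
Qed.

(** * Passage to the limit *)

Lemma sol_lim r s :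
  is_lim_seq (fun n => sol r s n / (hyp n * cpoly n)) (r + s * (PI ^ 2 / 8)).
Proof.
  apply is_lim_seq_ext with (fun n => r + s * odd_quot_sum n + s * (ppoly n / cpoly n * odd_quot (S n))).
  { intro n. unfold sol. field. split; [apply ppoly_le_cpoly|apply hyp_neq_0]. }
  replace (Finite (r + s * (PI ^ 2 / 8)))
    with (Finite (r + s * (PI ^ 2 / 8) + s * 0)) by (f_equal; ring).
  apply is_lim_seq_plus'.
  - apply is_lim_seq_plus'; [apply is_lim_seq_const|].
    apply (is_lim_seq_scal_l _ s (PI ^ 2 / 8)), odd_quot_sum_lim.
  - apply (is_lim_seq_scal_l _ s 0), is_lim_seq_abs_0.
    apply is_lim_seq_le_le with (u := fun _ => 0) (w := fun n => odd_quot (S n)).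
    + intro n. split; [apply Rabs_pos|].
      destruct (ppoly_le_cpoly n) as [Hc Hp]. apply Rabs_pos_lt in Hc as Hc'.
      pose proof (odd_quot_pos (S n)).
      rewrite Rabs_mult, (Rabs_pos_eq (odd_quot (S n))), Rabs_div by lra.
      rewrite <- (Rmult_1_l (odd_quot (S n))) at 2.
      apply Rmult_le_compat_r; [lra|]. apply Rle_div_l; lra.
    + apply is_lim_seq_const.
    + apply odd_quot_S_lim.
Qed.

(** The Leibniz sum 1 - 1/3 + 1/5 = 13/15 bounds PI/4 from above. *)
Lemma PI_lt_4 : PI < 4.
Proof.
  pose proof (proj2 (PI_ineq 1)) as H.
  unfold tg_alt, PI_tg in H. simpl in H. lra.
Qed.

Theorem corollary2p30 :
  is_CF (fun n : nat => 3 * INR n ^ 2 + 9 * INR n + 7)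
        (fun n : nat => - ((INR n + 1) ^ 3 * (2 * INR n - 3)))
        ((16 + 3 * PI ^ 2) / (16 - PI ^ 2)).
Proof.
  set (a := fun n : nat => _). set (b := fun n : nat => - _).
  assert (HPI : PI ^ 2 < 16).
  { pose proof PI_lt_4. pose proof PI_RGT_0. nra. }
  assert (N : eventually (fun n => cf_den a b n <> 0)).
  { pose proof (proj2 (is_lim_seq_spec _ _) (sol_lim (-2) 1)) as L.
    (* The limit -2 + PI^2/8 is negative. Its absolute value serves as epsilon: a zero denominator
       would lie at exactly that distance from the limit. *)
    assert (He : 0 < 2 - PI ^ 2 / 8) by lra.
    destruct (L (mkposreal _ He)) as [M HM]. exists M. intros n Hn H0.
    specialize (HM n Hn). simpl in HM. unfold a, b in H0.
    rewrite <- cf_den_sol, H0 in HM.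
    unfold Rdiv in HM. rewrite Rmult_0_r, Rmult_0_l, Rabs_pos_eq in HM; lra. }
  split; [exact N|].
  (* The factor 64 and the common normalisation cancel in the quotient. *)
  apply is_lim_seq_ext_loc with
    (fun n => sol (-2) (-3) n / (hyp n * cpoly n) / (sol (-2) 1 n / (hyp n * cpoly n))).
  - destruct N as [M HM]. exists M. intros n Hn. specialize (HM n Hn).
    rewrite <- cf_num_sol, <- cf_den_sol. fold a b. field.
    repeat split; [exact HM|apply ppoly_le_cpoly|apply hyp_neq_0].
  - replace ((16 + 3 * PI ^ 2) / (16 - PI ^ 2)) with
      ((-2 + -3 * (PI ^ 2 / 8)) / (-2 + 1 * (PI ^ 2 / 8))) by (field; lra).
    apply is_lim_seq_div'; [apply sol_lim|apply sol_lim|lra].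
Qed.
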